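(* Let $I\subset\mathbb{R}$ be an interval and let $(\boldsymbol{\gamma},\boldsymbol{\nu}_1,\boldsymbol{\nu}_2):I\to\mathbb{R}^3\times\Delta$ be a framed curve with curvature $(\ell,m,n,\alpha)$ such that $m^2(t)+n^2(t)\neq0$ for all $t\in I$. If the constant $\theta_I$ in the definition of the Bishop frame $\{\boldsymbol{v}_I,\boldsymbol{w}_I,\boldsymbol{\eta}\}$ along the involute $I_{\boldsymbol{\gamma}}[t_0]$ is taken to be $\theta_I=\pi/2$, then the $\boldsymbol{v}_I$-evolute of the $t_0$-involute of $\boldsymbol{\gamma}$ satisfies $E_{I_{\boldsymbol{\gamma}}[t_0]}[\boldsymbol{v}_I](t)=\boldsymbol{\gamma}(t)$ for all $t\in I$, for any fixed $t_0\in I$.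
   Context: All maps are of class $C^\infty$. $S^2$ is the unit sphere in Euclidean space $\mathbb{R}^3$ and $\Delta=\{(\boldsymbol{x},\boldsymbol{y})\in S^2\times S^2\mid \boldsymbol{x}\cdot\boldsymbol{y}=0\}$. Framed curve: a smooth map $(\boldsymbol{\gamma},\boldsymbol{\nu}_1,\boldsymbol{\nu}_2):I\to\mathbb{R}^3\times\Delta$ with $\dot{\boldsymbol{\gamma}}\cdot\boldsymbol{\nu}_1=\dot{\boldsymbol{\gamma}}\cdot\boldsymbol{\nu}_2=0$ on $I$. Its unit tangent vector is $\boldsymbol{\mu}=\boldsymbol{\nu}_1\times\boldsymbol{\nu}_2$, and its curvature is $(\ell,m,n,\alpha)$ with $\ell=\dot{\boldsymbol{\nu}}_1\cdot\boldsymbol{\nu}_2$, $m=\dot{\boldsymbol{\nu}}_1\cdot\boldsymbol{\mu}$, $n=\dot{\boldsymbol{\nu}}_2\cdot\boldsymbol{\mu}$, $\alpha=\dot{\boldsymbol{\gamma}}\cdot\boldsymbol{\mu}$ (so $\dot{\boldsymbol{\gamma}}=\alpha\boldsymbol{\mu}$). The moving frame is a Bishop frame if $\ell\equiv0$. Involute: if $m^2+n^2$ is nowhere zero and $t_0\in I$, the $t_0$-involute is $I_{\boldsymbol{\gamma}}[t_0](t)=\boldsymbol{\gamma}(t)-\left(\int_{t_0}^t\alpha(\tau)\,d\tau\right)\boldsymbol{\mu}(t)$. Put $$\boldsymbol{\xi}=\frac{n\boldsymbol{\nu}_1-m\boldsymbol{\nu}_2}{\sqrt{m^2+n^2}},\qquad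 \boldsymbol{\eta}=\boldsymbol{\xi}\times\boldsymbol{\mu}=\frac{-m\boldsymbol{\nu}_1-n\boldsymbol{\nu}_2}{\sqrt{m^2+n^2}},$$ and, for a constant $\theta_I\in\mathbb{R}$, $\boldsymbol{v}_I=\cos\theta_I\,\boldsymbol{\xi}-\sin\theta_I\,\boldsymbol{\mu}$, $\boldsymbol{w}_I=\sin\theta_I\,\boldsymbol{\xi}+\cos\theta_I\,\boldsymbol{\mu}$. Then $(I_{\boldsymbol{\gamma}}[t_0],\boldsymbol{v}_I,\boldsymbol{w}_I)$ is a framed curve with unit tangent vector $\boldsymbol{v}_I\times\boldsymbol{w}_I=\boldsymbol{\eta}$, and $\{\boldsymbol{v}_I,\boldsymbol{w}_I,\boldsymbol{\eta}\}$ is a Bishop frame along $I_{\boldsymbol{\gamma}}[t_0]$. Write $m_I=\dot{\boldsymbol{v}}_I\cdot\boldsymbol{\eta}$ and $\alpha_I=\dot{I}_{\boldsymbol{\gamma}}[t_0]\cdot\boldsymbol{\eta}$. Circular evolute: for a framed curve $(\boldsymbol{\gamma},\boldsymbol{v},\boldsymbol{w})$ whose frame $\{\boldsymbol{v},\boldsymbol{w},\boldsymbol{\mu}\}$ is a Bishop frame and with $\overline{m}=\dot{\boldsymbol{v}}\cdot\boldsymbol{\mu}$ nowhere zero, the $\boldsymbol{v}$-evolute is $E_{\boldsymbol{\gamma}}[\boldsymbol{v}]=\boldsymbol{\gamma}-\frac{\alpha}{\overline{m}}\boldsymbol{v}$. Thus $E_{I_{\boldsymbol{\gamma}}[t_0]}[\boldsymbol{v}_I]=I_{\boldsymbol{\gamma}}[t_0]-\frac{\alpha_I}{m_I}\boldsymbol{v}_I$.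 *)

(* Defs.v *)
From Stdlib Require Import Reals Lra.
From Coquelicot Require Import Coquelicot.
Open Scope R_scope.

(** ** Calculus on an interval

    An interval is a convex subset of [R] with at least two points; it may be
    open, closed or half-open, bounded or not.  Functions on [I] are
    represented by total functions whose values outside [I] play no role. *)

Definition is_interval (I : R -> Prop) : Prop :=
  (forall x y z, I x -> I z -> x <= y <= z -> I y) /\
  (exists a b, I a /\ I b /\ a < b).

(** Coquelicot's [is_derive] with [locally t] replaced by [within I (locally t)]:
    the usual derivative at interior points of [I], one-sided at the end points. *)
Definition is_derive_on (I : R -> Prop) (f : R -> R) (t l : R) : Prop :=
  filterdiff f (within I (locally t)) (fun h => scal h l).

Definition ex_derive_on (I : R -> Prop) (f : R -> R) (t : R) : Prop :=
  exists l, is_derive_on I f t l.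

Definition Derive_on (I : R -> Prop) (f : R -> R) (t : R) : R :=
  iota (is_derive_on I f t).

Fixpoint Derive_n_on (I : R -> Prop) (f : R -> R) (k : nat) : R -> R :=
  match k with
  | O => f
  | S k => Derive_on I (Derive_n_on I f k)
  end.

Definition smooth_on (I : R -> Prop) (f : R -> R) : Prop :=
  forall k t, I t -> ex_derive_on I (Derive_n_on I f k) t.

(** A derivative relative to a nondegenerate interval is unique, so the choice
    operator [iota] in [Derive_on] picks the derivative whenever it exists. *)
Lemma Derive_on_unique (I : R -> Prop) (f : R -> R) (t l : R) :
  is_interval I -> I t -> is_derive_on I f t l -> Derive_on I f t = l.
Proof.
  intros [Hc [a [b [Ha [Hb Hab]]]]] Ht Hl.
  unfold Derive_on.
  apply (@iota_unique R_AbsRing R_CompleteNormedModule (is_derive_on I f t) l);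
    [|exact Hl].
  intros k Hk.
  destruct (Req_dec k l) as [|Hne]; [assumption|exfalso].
  assert (Hlim : is_filter_lim (within I (locally t)) t).
  { intros P [e HP]. exists e. intros y Hy _. exact (HP y Hy). }
  assert (Hpos : 0 < Rabs (k - l) / 4).
  { apply Rdiv_lt_0_compat; [apply Rabs_pos_lt; lra | lra]. }
  destruct Hl as [_ Hl]. destruct Hk as [_ Hk].
  destruct (Hl t Hlim (mkposreal _ Hpos)) as [d1 H1].
  destruct (Hk t Hlim (mkposreal _ Hpos)) as [d2 H2].
  set (d := Rmin d1 d2).
  assert (Hd : 0 < d) by (apply Rmin_pos; [apply d1 | apply d2]).
  assert (Hs : exists s, I s /\ s <> t /\ Rabs (s - t) < d).
  { destruct (Rlt_dec t b) as [Htb|Htb].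
    - exists (Rmin b (t + d / 2)).
      assert (t < Rmin b (t + d / 2)) by (apply Rmin_glb_lt; lra).
      pose proof (Rmin_l b (t + d / 2)). pose proof (Rmin_r b (t + d / 2)).
      split; [apply (Hc t _ b); auto; lra|].
      split; [lra|]. rewrite Rabs_right; lra.
    - exists (Rmax a (t - d / 2)).
      assert (Rmax a (t - d / 2) < t) by (apply Rmax_lub_lt; lra).
      pose proof (Rmax_l a (t - d / 2)). pose proof (Rmax_r a (t - d / 2)).
      split; [apply (Hc a _ t); auto; lra|].
      split; [lra|]. rewrite Rabs_left; lra. }
  destruct Hs as [s [HIs [Hst Hsd]]].
  assert (B1 : ball t d1 s).
  { change (Rabs (s - t) < d1). pose proof (Rmin_l d1 d2). unfold d in *; lra. }
  assert (B2 : ball t d2 s).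
  { change (Rabs (s - t) < d2). pose proof (Rmin_r d1 d2). unfold d in *; lra. }
  specialize (H1 s B1 HIs). specialize (H2 s B2 HIs).
  change (Rabs ((f s - f t) - (s - t) * l) <= Rabs (k - l) / 4 * Rabs (s - t)) in H1.
  change (Rabs ((f s - f t) - (s - t) * k) <= Rabs (k - l) / 4 * Rabs (s - t)) in H2.
  assert (E : Rabs (k - l) * Rabs (s - t) <=
    Rabs ((f s - f t) - (s - t) * l) + Rabs ((f s - f t) - (s - t) * k)).
  { rewrite <- Rabs_mult.
    replace ((k - l) * (s - t)) with
      (((f s - f t) - (s - t) * l) + - ((f s - f t) - (s - t) * k)) by ring.
    eapply Rle_trans; [apply Rabs_triang|]. rewrite Rabs_Ropp. lra. }
  assert (0 < Rabs (s - t)) by (apply Rabs_pos_lt; lra).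
  nra.
Qed.

(** ** Euclidean space *)

Definition R3 : Type := (R * R * R)%type.

Definition cx (u : R3) : R := fst (fst u).
Definition cy (u : R3) : R := snd (fst u).
Definition cz (u : R3) : R := snd u.

Definition vadd (u v : R3) : R3 := plus u v.
Definition vsub (u v : R3) : R3 := minus u v.
Definition vscal (a : R) (u : R3) : R3 := scal a u.

Definition dot (u v : R3) : R := cx u * cx v + cy u * cy v + cz u * cz v.

Definition cross (u v : R3) : R3 :=
  (cy u * cz v - cz u * cy v,
   cz u * cx v - cx u * cz v,
   cx u * cy v - cy u * cx v).

Definition in_S2 (u : R3) : Prop := dot u u = 1.

Definition in_Delta (u v : R3) : Prop := in_S2 u /\ in_S2 v /\ dot u v = 0.

Definition smooth_curve_on (I : R -> Prop) (c : R -> R3) : Prop :=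
  smooth_on I (fun t => cx (c t)) /\
  smooth_on I (fun t => cy (c t)) /\
  smooth_on I (fun t => cz (c t)).

Definition velocity (I : R -> Prop) (c : R -> R3) (t : R) : R3 :=
  (Derive_on I (fun s => cx (c s)) t,
   Derive_on I (fun s => cy (c s)) t,
   Derive_on I (fun s => cz (c s)) t).

(** ** Framed curves *)

Definition framed_curve (I : R -> Prop) (gamma nu1 nu2 : R -> R3) : Prop :=
  smooth_curve_on I gamma /\ smooth_curve_on I nu1 /\ smooth_curve_on I nu2 /\
  forall t, I t ->
    in_Delta (nu1 t) (nu2 t) /\
    dot (velocity I gamma t) (nu1 t) = 0 /\
    dot (velocity I gamma t) (nu2 t) = 0.

Definition mu (nu1 nu2 : R -> R3) (t : R) : R3 := cross (nu1 t) (nu2 t).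

(** The curvature [(l, m, n, alpha)]; the component [l], whose vanishing
    characterizes Bishop frames, is [curv_l]. *)
Definition curv_l (I : R -> Prop) (nu1 nu2 : R -> R3) (t : R) : R :=
  dot (velocity I nu1 t) (nu2 t).
Definition curv_m (I : R -> Prop) (nu1 nu2 : R -> R3) (t : R) : R :=
  dot (velocity I nu1 t) (mu nu1 nu2 t).
Definition curv_n (I : R -> Prop) (nu1 nu2 : R -> R3) (t : R) : R :=
  dot (velocity I nu2 t) (mu nu1 nu2 t).
Definition curv_alpha (I : R -> Prop) (gamma nu1 nu2 : R -> R3) (t : R) : R :=
  dot (velocity I gamma t) (mu nu1 nu2 t).

Definition is_Bishop (I : R -> Prop) (nu1 nu2 : R -> R3) : Prop :=
  forall t, I t -> curv_l I nu1 nu2 t = 0.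

(** ** Involutes *)

(** [RInt] is the oriented integral, so [t < t0] is allowed. *)
Definition involute (I : R -> Prop) (gamma nu1 nu2 : R -> R3) (t0 t : R) : R3 :=
  vsub (gamma t)
       (vscal (RInt (curv_alpha I gamma nu1 nu2) t0 t) (mu nu1 nu2 t)).

Definition xi (I : R -> Prop) (nu1 nu2 : R -> R3) (t : R) : R3 :=
  let m := curv_m I nu1 nu2 t in
  let n := curv_n I nu1 nu2 t in
  vscal (/ sqrt (m ^ 2 + n ^ 2)) (vsub (vscal n (nu1 t)) (vscal m (nu2 t))).

(** The frame [{v_I, w_I}] along the involute; its unit tangent vector
    [mu (v_I ..) (w_I ..)] is [cross xi mu], the vector usually called eta. *)
Definition v_I (I : R -> Prop) (nu1 nu2 : R -> R3) (theta t : R) : R3 :=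
  vsub (vscal (cos theta) (xi I nu1 nu2 t))
       (vscal (sin theta) (mu nu1 nu2 t)).
Definition w_I (I : R -> Prop) (nu1 nu2 : R -> R3) (theta t : R) : R3 :=
  vadd (vscal (sin theta) (xi I nu1 nu2 t))
       (vscal (cos theta) (mu nu1 nu2 t)).

(** ** Circular evolutes *)

(** The [v]-evolute of [(gamma, v, w)]; it is meaningful when [{v, w, mu v w}]
    is a Bishop frame and [curv_m I v w] has no zero on [I]. *)
Definition evolute (I : R -> Prop) (gamma v w : R -> R3) (t : R) : R3 :=
  vsub (gamma t)
       (vscal (curv_alpha I gamma v w t / curv_m I v w t) (v t)).

(* Main.v *)
Require Import Defs.
From Stdlib Require Import Reals Lra.
From Coquelicot Require Import Coquelicot.
Open Scope R_scope.

(** Everything rests on the fact that, for [theta = PI / 2], the frame vector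
    [v_I] is [- mu] and the unit tangent vector of the involute is
    [eta = - (m nu1 + n nu2) / sqrt (m ^ 2 + n ^ 2)], which is orthogonal to
    [mu].  Write [A t] for the integral of [alpha] from [t0] to [t].  Then the
    involute is [gamma - A mu = gamma + A v_I], and its velocity is
    [gamma' - alpha mu - A mu'].  Both [gamma'] and [mu] are orthogonal to
    [eta], so [alpha_I = - A (mu' . eta) = A (v_I' . eta) = A m_I].  Hence the
    evolute is [gamma + A v_I - (alpha_I / m_I) v_I = gamma]; the division is
    legitimate because [mu' . nu1 = - m] and [mu' . nu2 = - n] give
    [m_I = - (m ^ 2 + n ^ 2) / sqrt (m ^ 2 + n ^ 2)], which has no zero.

    The analytic content is the identity [A' = alpha] on [I], end points
    included.  There [alpha] is only known to be continuous relative to [I],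
    and nothing is known about its values outside [I]; integrability over
    subintervals of [I] comes from [ex_RInt_continuous_on], and the derivative
    from [is_derive_on_RInt]. *)

(** * Derivatives relative to an interval *)

Global Instance within_proper (I : R -> Prop) (t : R) :
  I t -> ProperFilter (within I (locally t)).
Proof.
  intros Ht. constructor.
  - intros P [e He]. exists t. exact (He t (ball_center t e) Ht).
  - apply within_filter, locally_filter.
Qed.

(** [filterdiff] quantifies over all limit points of its filter; a proper filter
    on a separated space has at most one, and for [within I (locally t)] it is
    [t], so only the estimate at [t] remains. *)
Lemma is_derive_on_eps (I : R -> Prop) (f : R -> R) (t l : R) :
  I t ->
  is_derive_on I f t l <->
  forall eps : posreal, exists d : posreal, forall s, I s -> Rabs (s - t) < d ->
    Rabs (f s - f t - (s - t) * l) <= eps * Rabs (s - t).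
Proof.
  intros Ht.
  assert (Hlim : is_filter_lim (within I (locally t)) t).
  { intros P [e HP]. exists e. intros y Hy _. exact (HP y Hy). }
  split.
  - intros [_ Hl] eps. destruct (Hl t Hlim eps) as [d Hd].
    exists d. intros s Is Hs. exact (Hd s Hs Is).
  - intros H. split; [exact (is_linear_scal_l l)|].
    intros x Hx.
    assert (E : t = x).
    { apply (@is_filter_lim_unique R_AbsRing R_NormedModule
               (within I (locally t)) (Proper_StrongProper _ (within_proper I t Ht))); assumption. }
    subst x. intros eps. destruct (H eps) as [d Hd].
    exists d. intros s Hs Is. exact (Hd s Is Hs).
Qed.

Lemma is_derive_on_continuous (I : R -> Prop) (f : R -> R) (t l : R) :
  I t -> is_derive_on I f t l -> filterlim f (within I (locally t)) (locally (f t)).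
Proof.
  intros Ht Hl.
  rewrite is_derive_on_eps in Hl by exact Ht.
  apply filterlim_locally. intros eps.
  destruct (Hl (mkposreal 1 Rlt_0_1)) as [d Hd]. cbn in Hd.
  assert (Hp : 0 < Rabs l + 1) by (pose proof (Rabs_pos l); lra).
  assert (He : 0 < Rmin d (eps / (Rabs l + 1))).
  { apply Rmin_pos; [apply cond_pos|].
    apply Rdiv_lt_0_compat; [apply cond_pos | exact Hp]. }
  exists (mkposreal _ He). intros s Hs Is.
  change (Rabs (s - t) < Rmin d (eps / (Rabs l + 1))) in Hs.
  change (Rabs (f s - f t) < eps).
  pose proof (Rmin_l d (eps / (Rabs l + 1))).
  pose proof (Rmin_r d (eps / (Rabs l + 1))).
  specialize (Hd s Is ltac:(lra)).
  assert (Hb : Rabs (s - t) * (Rabs l + 1) < eps).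
  { apply Rmult_lt_reg_r with (/ (Rabs l + 1)); [apply Rinv_0_lt_compat, Hp|].
    rewrite Rmult_assoc, Rinv_r, Rmult_1_r by lra.
    apply Rlt_le_trans with (1 := Hs). assumption. }
  replace (f s - f t) with ((f s - f t - (s - t) * l) + (s - t) * l) by ring.
  eapply Rle_lt_trans; [apply Rabs_triang|].
  rewrite (Rabs_mult (s - t) l). lra.
Qed.

Lemma is_derive_on_ext (I : R -> Prop) (f g : R -> R) (t l : R) :
  (forall s, f s = g s) -> is_derive_on I f t l -> is_derive_on I g t l.
Proof. intros E. apply filterdiff_ext, E. Qed.

Lemma is_derive_on_plus (I : R -> Prop) (f g : R -> R) (t lf lg : R) :
  is_derive_on I f t lf -> is_derive_on I g t lg ->
  is_derive_on I (fun s => f s + g s) t (lf + lg).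
Proof.
  intros Hf Hg.
  eapply filterdiff_ext_lin; [exact (filterdiff_plus_fct _ _ _ _ Hf Hg)|].
  intros y. symmetry. apply (Rmult_plus_distr_l y lf lg).
Qed.

Lemma is_derive_on_minus (I : R -> Prop) (f g : R -> R) (t lf lg : R) :
  is_derive_on I f t lf -> is_derive_on I g t lg ->
  is_derive_on I (fun s => f s - g s) t (lf - lg).
Proof.
  intros Hf Hg.
  eapply filterdiff_ext_lin; [exact (filterdiff_minus_fct _ _ _ _ Hf Hg)|].
  intros y. change (y * lf - y * lg = y * (lf - lg)). ring.
Qed.

Lemma is_derive_on_const (I : R -> Prop) (a t : R) :
  is_derive_on I (fun _ => a) t 0.
Proof.
  eapply filterdiff_ext_lin; [apply filterdiff_const|].
  intros y. change (0 = y * 0). ring.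
Qed.

(** The expansion
    [f g - f t g t = (f - f t) g t + f t (g - g t) + (f - f t) (g - g t)]
    is carried out by [filterdiff_mult] along the image of
    [within I (locally t)] under [(f, g)], which converges to [(f t, g t)] by
    the continuity of [f] and [g] relative to [I] at [t]. *)
Lemma is_derive_on_mult (I : R -> Prop) (f g : R -> R) (t lf lg : R) :
  I t -> is_derive_on I f t lf -> is_derive_on I g t lg ->
  is_derive_on I (fun s => f s * g s) t (lf * g t + f t * lg).
Proof.
  intros Ht Hf Hg.
  pose proof (is_derive_on_continuous I f t lf Ht Hf) as Cf.
  pose proof (is_derive_on_continuous I g t lg Ht Hg) as Cg.
  pose proof (within_proper I t Ht) as PF.
  eapply filterdiff_ext_lin.
  - apply (filterdiff_comp_2 (F := within I (locally t)) f g Rmult _ _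
             (fun a b => plus (mult a (g t)) (mult (f t) b)) Hf Hg).
    apply (filterdiff_mult (K := R_AbsRing) (f t, g t)).
    + intros P [e HP].
      destruct (Cf _ (locally_ball (f t) e)) as [d1 B1].
      destruct (Cg _ (locally_ball (g t) e)) as [d2 B2].
      exists (mkposreal _ (Rmin_stable_in_posreal d1 d2)). intros s Hs Is.
      apply HP. split.
      * apply (B1 s); [exact (Rlt_le_trans _ _ _ Hs (Rmin_l d1 d2)) | exact Is].
      * apply (B2 s); [exact (Rlt_le_trans _ _ _ Hs (Rmin_r d1 d2)) | exact Is].
    + exact Rmult_comm.
  - intros y. change (y * lf * g t + f t * (y * lg) = y * (lf * g t + f t * lg)).
    ring.
Qed.

(** * Integration relative to an interval *)

(** Composing [f] with the retraction of [R] onto the segment [[a, b]] gives a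
    function continuous on all of [R], with the same integral. *)
Lemma ex_RInt_continuous_on (I : R -> Prop) (f : R -> R) (a b : R) :
  is_interval I -> continuous_on I f -> I a -> I b -> ex_RInt f a b.
Proof.
  intros [HI _] Cf.
  assert (Hle : forall a b, I a -> I b -> a <= b -> ex_RInt f a b).
  { clear a b. intros a b Ia Ib Hab.
    set (p := fun x => Rmax a (Rmin b x)).
    assert (Ip : forall x, I (p x)).
    { intros x. apply (HI a _ b Ia Ib). unfold p. split; [apply Rmax_l|].
      apply Rmax_lub; [exact Hab | apply Rmin_l]. }
    assert (Lp : forall x y, Rabs (p y - p x) <= Rabs (y - x)).
    { intros x y. unfold p, Rmax, Rmin.
      repeat destruct Rle_dec; unfold Rabs; repeat destruct Rcase_abs; lra. }
    apply ex_RInt_ext with (f := fun x => f (p x)).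
    - intros x. rewrite Rmin_left, Rmax_right by exact Hab. intros Hx.
      unfold p. rewrite Rmin_right, Rmax_right by lra. reflexivity.
    - apply (ex_RInt_continuous (V := R_CompleteNormedModule)). intros z _.
      apply filterlim_comp with (2 := Cf (p z) (Ip z)).
      intros P [e HP]. exists e. intros y Hy. apply HP; [|apply Ip].
      apply Rle_lt_trans with (1 := Lp z y). exact Hy. }
  intros Ia Ib. destruct (Rle_lt_dec a b) as [Hab|Hba].
  - apply Hle; assumption.
  - apply ex_RInt_swap, Hle; [assumption..|lra].
Qed.

(** The fundamental theorem of calculus relative to [I]: since [I] is convex,
    the integral of [f] from [t] to [s] only involves points of [I] at least as
    close to [t] as [s], where [f] differs little from [f t]. *)
Lemma is_derive_on_RInt (I : R -> Prop) (f : R -> R) (t0 t : R) :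
  is_interval I -> continuous_on I f -> I t0 -> I t ->
  is_derive_on I (RInt f t0) t (f t).
Proof.
  intros HI Cf It0 It. apply is_derive_on_eps; [exact It|]. intros eps.
  destruct (proj1 (filterlim_locally _ _) (Cf t It) eps) as [d Hd].
  exists d. intros s Is Hs.
  assert (E1 := ex_RInt_continuous_on I f t0 t HI Cf It0 It).
  assert (E2 := ex_RInt_continuous_on I f t s HI Cf It Is).
  assert (Hc : is_RInt (fun x => f x - f t) t s (RInt f t s - (s - t) * f t)).
  { apply (is_RInt_minus (V := R_NormedModule)).
    - exact (RInt_correct f t s E2).
    - exact (is_RInt_const t s (f t)). }
  rewrite <- (RInt_Chasles f t0 t s E1 E2).
  replace (plus (RInt f t0 t) (RInt f t s) - RInt f t0 t - (s - t) * f t)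
    with (RInt f t s - (s - t) * f t) by (unfold plus; simpl; ring).
  rewrite (Rmult_comm eps).
  apply (norm_RInt_le_const_abs (V := R_NormedModule) _ _ _ _ eps) with (2 := Hc).
  intros x Hx. apply Rlt_le.
  assert (Ix : I x).
  { apply (proj1 HI (Rmin t s) x (Rmax t s)); [| |exact Hx].
    - unfold Rmin; destruct Rle_dec; assumption.
    - unfold Rmax; destruct Rle_dec; assumption. }
  apply (Hd x); [|exact Ix].
  change (Rabs (x - t) < d). apply Rle_lt_trans with (2 := Hs).
  revert Hx. unfold Rmin, Rmax. destruct Rle_dec;
    unfold Rabs; repeat destruct Rcase_abs; lra.
Qed.

(** * Velocities of space curves *)

Definition is_velocity (I : R -> Prop) (c : R -> R3) (t : R) (V : R3) : Prop :=
  is_derive_on I (fun s => cx (c s)) t (cx V) /\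
  is_derive_on I (fun s => cy (c s)) t (cy V) /\
  is_derive_on I (fun s => cz (c s)) t (cz V).

Lemma is_velocity_unique (I : R -> Prop) (c : R -> R3) (t : R) (V : R3) :
  is_interval I -> I t -> is_velocity I c t V -> velocity I c t = V.
Proof.
  intros HI It [H1 [H2 H3]]. unfold velocity.
  rewrite (Derive_on_unique _ _ _ _ HI It H1), (Derive_on_unique _ _ _ _ HI It H2),
    (Derive_on_unique _ _ _ _ HI It H3).
  destruct V as [[? ?] ?]; reflexivity.
Qed.

Lemma is_velocity_ext (I : R -> Prop) (c d : R -> R3) (t : R) (V : R3) :
  (forall s, c s = d s) -> is_velocity I c t V -> is_velocity I d t V.
Proof.
  intros E [H1 [H2 H3]].
  split; [|split]; eapply is_derive_on_ext; try eassumption;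
    intros s; cbv beta; now rewrite E.
Qed.

Lemma ex_derive_on_correct (I : R -> Prop) (f : R -> R) (t : R) :
  is_interval I -> I t -> ex_derive_on I f t -> is_derive_on I f t (Derive_on I f t).
Proof.
  intros HI It [l Hl]. rewrite (Derive_on_unique _ _ _ _ HI It Hl). exact Hl.
Qed.

Lemma smooth_is_velocity (I : R -> Prop) (c : R -> R3) (t : R) :
  is_interval I -> smooth_curve_on I c -> I t -> is_velocity I c t (velocity I c t).
Proof.
  intros HI [S1 [S2 S3]] It.
  split; [|split]; apply ex_derive_on_correct; try assumption;
    [exact (S1 0%nat t It) | exact (S2 0%nat t It) | exact (S3 0%nat t It)].
Qed.

Lemma smooth_is_acceleration (I : R -> Prop) (c : R -> R3) (t : R) :
  is_interval I -> smooth_curve_on I c -> I t ->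
  is_velocity I (velocity I c) t (velocity I (velocity I c) t).
Proof.
  intros HI [S1 [S2 S3]] It.
  split; [|split]; apply ex_derive_on_correct; try assumption;
    [exact (S1 1%nat t It) | exact (S2 1%nat t It) | exact (S3 1%nat t It)].
Qed.

Lemma is_derive_on_dot (I : R -> Prop) (c d : R -> R3) (t : R) (V W : R3) :
  I t -> is_velocity I c t V -> is_velocity I d t W ->
  is_derive_on I (fun s => dot (c s) (d s)) t (dot V (d t) + dot (c t) W).
Proof.
  intros It [Cx [Cy Cz]] [Dx [Dy Dz]].
  pose proof (is_derive_on_plus _ _ _ _ _ _ (is_derive_on_plus _ _ _ _ _ _
    (is_derive_on_mult _ _ _ _ _ _ It Cx Dx) (is_derive_on_mult _ _ _ _ _ _ It Cy Dy))
    (is_derive_on_mult _ _ _ _ _ _ It Cz Dz)) as H.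
  eapply eq_ind with (1 := H). unfold dot. ring.
Qed.

Lemma is_velocity_cross (I : R -> Prop) (c d : R -> R3) (t : R) (V W : R3) :
  I t -> is_velocity I c t V -> is_velocity I d t W ->
  is_velocity I (fun s => cross (c s) (d s)) t
    (vadd (cross V (d t)) (cross (c t) W)).
Proof.
  intros It [Cx [Cy Cz]] [Dx [Dy Dz]].
  assert (H : forall f g h k a b a' b',
    is_derive_on I f t a -> is_derive_on I g t b ->
    is_derive_on I h t a' -> is_derive_on I k t b' ->
    is_derive_on I (fun s => f s * g s - h s * k s) t
      ((a * g t - a' * k t) + (f t * b - h t * b'))).
  { intros f g h k a b a' b' Hf Hg Hh Hk.
    pose proof (is_derive_on_minus _ _ _ _ _ _
      (is_derive_on_mult _ _ _ _ _ _ It Hf Hg)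
      (is_derive_on_mult _ _ _ _ _ _ It Hh Hk)) as H.
    eapply eq_ind with (1 := H). ring. }
  split; [|split].
  - exact (H _ _ _ _ _ _ _ _ Cy Dz Cz Dy).
  - exact (H _ _ _ _ _ _ _ _ Cz Dx Cx Dz).
  - exact (H _ _ _ _ _ _ _ _ Cx Dy Cy Dx).
Qed.

Lemma is_velocity_vscal (I : R -> Prop) (f : R -> R) (c : R -> R3) (t a : R) (V : R3) :
  I t -> is_derive_on I f t a -> is_velocity I c t V ->
  is_velocity I (fun s => vscal (f s) (c s)) t
    (vadd (vscal a (c t)) (vscal (f t) V)).
Proof.
  intros It Hf [Cx [Cy Cz]].
  split; [|split].
  - exact (is_derive_on_mult _ _ _ _ _ _ It Hf Cx).
  - exact (is_derive_on_mult _ _ _ _ _ _ It Hf Cy).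
  - exact (is_derive_on_mult _ _ _ _ _ _ It Hf Cz).
Qed.

Lemma is_velocity_vsub (I : R -> Prop) (c d : R -> R3) (t : R) (V W : R3) :
  is_velocity I c t V -> is_velocity I d t W ->
  is_velocity I (fun s => vsub (c s) (d s)) t (vsub V W).
Proof.
  intros [Cx [Cy Cz]] [Dx [Dy Dz]].
  split; [|split].
  - exact (is_derive_on_minus _ _ _ _ _ _ Cx Dx).
  - exact (is_derive_on_minus _ _ _ _ _ _ Cy Dy).
  - exact (is_derive_on_minus _ _ _ _ _ _ Cz Dz).
Qed.

(** * Vector algebra *)

Lemma R3_ext (u v : R3) : cx u = cx v -> cy u = cy v -> cz u = cz v -> u = v.
Proof.
  destruct u as [[? ?] ?], v as [[? ?] ?].
  intros H1 H2 H3. cbn in H1, H2, H3. now subst.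
Qed.

Ltac vector_ring :=
  try apply R3_ext;
  repeat match goal with u : R3 |- _ => destruct u as [[? ?] ?] end;
  unfold dot, cross, vadd, vsub, vscal, minus, plus, opp, scal, cx, cy, cz;
  cbn; unfold mult, plus, opp; cbn; ring.

Lemma dot_vadd_l (u v w : R3) : dot (vadd u v) w = dot u w + dot v w.
Proof. vector_ring. Qed.

Lemma dot_vsub_l (u v w : R3) : dot (vsub u v) w = dot u w - dot v w.
Proof. vector_ring. Qed.

Lemma dot_vscal_l (a : R) (u v : R3) : dot (vscal a u) v = a * dot u v.
Proof. vector_ring. Qed.

Lemma dot_vadd_r (u v w : R3) : dot u (vadd v w) = dot u v + dot u w.
Proof. vector_ring. Qed.

Lemma dot_vscal_r (a : R) (u v : R3) : dot u (vscal a v) = a * dot u v.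
Proof. vector_ring. Qed.

Lemma dot_cross_l (u v : R3) : dot (cross u v) u = 0.
Proof. vector_ring. Qed.

Lemma dot_cross_r (u v : R3) : dot (cross u v) v = 0.
Proof. vector_ring. Qed.

Lemma triple_cross (u v w : R3) :
  cross (cross u v) w = vsub (vscal (dot u w) v) (vscal (dot v w) u).
Proof. vector_ring. Qed.

(** The unit normal [cross u v] acts on the plane of [u] and [v] as a quarter
    turn; this is what takes [xi] to [- eta]. *)
Lemma cross_normal (u v : R3) (a b : R) :
  in_Delta u v ->
  cross (cross u v) (vsub (vscal a u) (vscal b v)) = vadd (vscal b u) (vscal a v).
Proof.
  intros [Hu [Hv Huv]]. unfold in_S2 in *.
  rewrite triple_cross.
  replace (dot u (vsub (vscal a u) (vscal b v))) with (a * dot u u - b * dot u v)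
    by (vector_ring).
  replace (dot v (vsub (vscal a u) (vscal b v))) with (a * dot u v - b * dot v v)
    by (vector_ring).
  rewrite Hu, Hv, Huv. vector_ring.
Qed.

(** * The frame along the involute *)

Lemma v_I_half_pi (I : R -> Prop) (nu1 nu2 : R -> R3) (t : R) :
  v_I I nu1 nu2 (PI / 2) t = vscal (-1) (mu nu1 nu2 t).
Proof.
  unfold v_I. rewrite cos_PI2, sin_PI2.
  generalize (xi I nu1 nu2 t) (mu nu1 nu2 t). intros u v.
  vector_ring.
Qed.

Lemma w_I_half_pi (I : R -> Prop) (nu1 nu2 : R -> R3) (t : R) :
  w_I I nu1 nu2 (PI / 2) t = xi I nu1 nu2 t.
Proof.
  unfold w_I. rewrite cos_PI2, sin_PI2.
  generalize (xi I nu1 nu2 t) (mu nu1 nu2 t). intros u v.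
  vector_ring.
Qed.

Lemma mu_I_half_pi (I : R -> Prop) (nu1 nu2 : R -> R3) (t : R) :
  in_Delta (nu1 t) (nu2 t) ->
  let m := curv_m I nu1 nu2 t in
  let n := curv_n I nu1 nu2 t in
  mu (v_I I nu1 nu2 (PI / 2)) (w_I I nu1 nu2 (PI / 2)) t =
  vscal (- / sqrt (m ^ 2 + n ^ 2)) (vadd (vscal m (nu1 t)) (vscal n (nu2 t))).
Proof.
  intros HD m n. unfold mu at 1. rewrite v_I_half_pi, w_I_half_pi.
  unfold xi. fold m n. rewrite <- (cross_normal (nu1 t) (nu2 t) n m HD).
  generalize (/ sqrt (m ^ 2 + n ^ 2)). intros r.
  unfold mu. generalize (cross (nu1 t) (nu2 t)) (vsub (vscal n (nu1 t)) (vscal m (nu2 t))).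
  intros u v. vector_ring.
Qed.

(** Used with [u = nu1 t], [v = nu2 t] and [U], [V] their derivatives, so that
    [W] is the derivative of [mu]: [dot W nu1 = - m] and [dot W nu2 = - n].  In
    each product one summand of [W] drops out, and the other is a triple product
    whose factors can be permuted cyclically. *)
Lemma dot_derive_mu (u v U V : R3) :
  let W := vadd (cross U v) (cross u V) in
  dot W u = - dot U (cross u v) /\ dot W v = - dot V (cross u v).
Proof. cbv zeta. split; vector_ring. Qed.

Section Involute.

Variables (I : R -> Prop) (gamma nu1 nu2 : R -> R3).
Hypotheses (HI : is_interval I) (HF : framed_curve I gamma nu1 nu2).

Lemma framed_curve_is_velocity_mu (t : R) :
  I t -> is_velocity I (mu nu1 nu2) t
    (vadd (cross (velocity I nu1 t) (nu2 t)) (cross (nu1 t) (velocity I nu2 t))).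
Proof.
  intros It. destruct HF as [_ [S1 [S2 _]]].
  apply is_velocity_cross; [exact It| |]; apply smooth_is_velocity; assumption.
Qed.

(** [alpha] pairs [gamma'] with [mu], and both are differentiable on [I]: the
    first because [gamma] has a second derivative. *)
Lemma framed_curve_continuous_alpha : continuous_on I (curv_alpha I gamma nu1 nu2).
Proof.
  intros t It. pose proof HF as [Sg _].
  eapply is_derive_on_continuous; [exact It|].
  apply is_derive_on_dot; [exact It| |].
  - apply smooth_is_acceleration; assumption.
  - apply framed_curve_is_velocity_mu, It.
Qed.

Lemma velocity_v_I_half_pi (t : R) :
  I t -> velocity I (v_I I nu1 nu2 (PI / 2)) t = vscal (-1) (velocity I (mu nu1 nu2) t).
Proof.
  intros It. pose proof (framed_curve_is_velocity_mu t It) as Hm.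
  rewrite (is_velocity_unique _ _ _ _ HI It Hm).
  apply is_velocity_unique; [assumption..|].
  eapply is_velocity_ext; [intros s; symmetry; apply v_I_half_pi|].
  pose proof (is_velocity_vscal I (fun _ => -1) _ t 0 _ It
    (is_derive_on_const I (-1) t) Hm) as H.
  eapply eq_ind with (1 := H).
  generalize (vadd (cross (velocity I nu1 t) (nu2 t)) (cross (nu1 t) (velocity I nu2 t)))
    (mu nu1 nu2 t). intros u v. vector_ring.
Qed.

Lemma velocity_involute (t0 t : R) :
  I t0 -> I t ->
  velocity I (involute I gamma nu1 nu2 t0) t =
  vsub (velocity I gamma t)
    (vadd (vscal (curv_alpha I gamma nu1 nu2 t) (mu nu1 nu2 t))
       (vscal (RInt (curv_alpha I gamma nu1 nu2) t0 t) (velocity I (mu nu1 nu2) t))).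
Proof.
  intros It0 It. pose proof (framed_curve_is_velocity_mu t It) as Hm.
  rewrite (is_velocity_unique _ _ _ _ HI It Hm).
  apply is_velocity_unique; [assumption..|].
  apply is_velocity_vsub.
  - apply smooth_is_velocity; [exact HI | exact (proj1 HF) | exact It].
  - apply is_velocity_vscal; [exact It| |exact Hm].
    apply is_derive_on_RInt; [exact HI | exact framed_curve_continuous_alpha | ..];
      assumption.
Qed.

Lemma curv_m_I_half_pi (t : R) :
  I t ->
  let m := curv_m I nu1 nu2 t in
  let n := curv_n I nu1 nu2 t in
  curv_m I (v_I I nu1 nu2 (PI / 2)) (w_I I nu1 nu2 (PI / 2)) t =
  - (m ^ 2 + n ^ 2) / sqrt (m ^ 2 + n ^ 2).
Proof.
  intros It m n.
  pose proof (framed_curve_is_velocity_mu t It) as Hm.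
  destruct HF as [_ [_ [_ HD]]]. destruct (HD t It) as [Hd _].
  destruct (dot_derive_mu (nu1 t) (nu2 t) (velocity I nu1 t) (velocity I nu2 t))
    as [E1 E2].
  unfold curv_m at 1.
  rewrite velocity_v_I_half_pi, (is_velocity_unique _ _ _ _ HI It Hm),
    mu_I_half_pi by assumption.
  fold m n. rewrite dot_vscal_l, dot_vscal_r, dot_vadd_r, !dot_vscal_r, E1, E2.
  change (dot (velocity I nu1 t) (cross (nu1 t) (nu2 t))) with m.
  change (dot (velocity I nu2 t) (cross (nu1 t) (nu2 t))) with n.
  unfold Rdiv. ring.
Qed.

(** The part [gamma' - alpha mu] of the velocity of the involute is orthogonal to
    [eta], each of its two terms separately; the rest is [- A mu' = A v_I'], where
    [A] is the integral of [alpha]. *)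
Lemma curv_alpha_I_half_pi (t0 t : R) :
  I t0 -> I t ->
  let v := v_I I nu1 nu2 (PI / 2) in
  let w := w_I I nu1 nu2 (PI / 2) in
  curv_alpha I (involute I gamma nu1 nu2 t0) v w t =
  RInt (curv_alpha I gamma nu1 nu2) t0 t * curv_m I v w t.
Proof.
  intros It0 It v w.
  pose proof HF as [_ [_ [_ HD]]]. destruct (HD t It) as [Hd [G1 G2]].
  unfold curv_alpha at 1, curv_m. unfold v at 2.
  rewrite velocity_involute, velocity_v_I_half_pi by assumption.
  unfold v, w. rewrite mu_I_half_pi by assumption.
  rewrite dot_vsub_l, dot_vadd_l, !dot_vscal_l, !dot_vscal_r, !dot_vadd_r,
    !dot_vscal_r, G1, G2.
  (* [mu] is now paired with [nu1] and [nu2]. *)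
  unfold mu at 1 2. rewrite dot_cross_l, dot_cross_r. ring.
Qed.

End Involute.

Theorem proposition4p3 :
  forall (I : R -> Prop) (gamma nu1 nu2 : R -> R3),
    is_interval I ->
    framed_curve I gamma nu1 nu2 ->
    (forall t, I t -> curv_m I nu1 nu2 t ^ 2 + curv_n I nu1 nu2 t ^ 2 <> 0) ->
    forall t0 : R, I t0 ->
    let Inv := involute I gamma nu1 nu2 t0 in
    let v := v_I I nu1 nu2 (PI / 2) in
    let w := w_I I nu1 nu2 (PI / 2) in
    (forall t, I t -> curv_m I v w t <> 0) /\
    (forall t, I t -> evolute I Inv v w t = gamma t).
Proof.
  intros I gamma nu1 nu2 HI HF Hmn t0 It0 Inv v w.
  assert (Hm : forall t, I t -> curv_m I v w t <> 0).
  { intros t It. unfold v, w. rewrite (curv_m_I_half_pi I gamma) by assumption.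
    specialize (Hmn t It).
    assert (Hs : sqrt (curv_m I nu1 nu2 t ^ 2 + curv_n I nu1 nu2 t ^ 2) <> 0).
    { intros E. apply Hmn, sqrt_eq_0; [|exact E].
      apply Rplus_le_le_0_compat; apply pow2_ge_0. }
    apply Rmult_integral_contrapositive_currified;
      [apply Ropp_neq_0_compat, Hmn | apply Rinv_neq_0_compat, Hs]. }
  split; [exact Hm|]. intros t It. unfold evolute, Inv, v, w.
  rewrite curv_alpha_I_half_pi by assumption. fold v w.
  unfold Rdiv. rewrite Rmult_assoc, Rinv_r, Rmult_1_r by exact (Hm t It).
  unfold v. rewrite v_I_half_pi. unfold involute.
  generalize (RInt (curv_alpha I gamma nu1 nu2) t0 t) (mu nu1 nu2 t) (gamma t).
  intros a u c. vector_ring.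
Qed.
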